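(* For each $\alpha \in [-\infty,\infty]$, let $$B(\alpha) := \left\{ x \in (0,1] : \lim_{n\to\infty} \frac{d_{n+1}(x)}{d_n(x)} = \alpha \right\}.$$ Then $\dim_H B(\alpha) = 1$ if $\alpha \in [1,\infty]$, and $\dim_H B(\alpha) = 0$ if $\alpha \in [-\infty,1)$, because in the latter case $B(\alpha) = \varnothing$.
   Context: Pierce expansion digits: for $x \in (0,1]$ put $d_1(x) := \lfloor 1/x \rfloor$ and $T(x) := 1 - d_1(x)x$, and for $k \in \mathbb{N}$ put $d_k(x) := d_1(T^{k-1}(x))$ provided $T^{k-1}(x) \neq 0$. All digits $d_k(x)$, $k \in \mathbb{N}$, are defined exactly when $x$ is irrational, and then they form a strictly increasing sequence of positive integers. Convention: a limiting condition on $(d_n(x))_n$, or a condition for all (large) $n$, is only considered for irrational $x$, so rational $x$ do not belong to sets defined by such conditions. $\mathbb{N}=\{1,2,\dots\}$, and $\dim_H$ is the Hausdorff dimension (with $\dim_H \varnothing = 0$). *)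

(* Defs.v *)
From HB Require Import structures.
From mathcomp Require Import all_boot all_order all_algebra.
From mathcomp Require Import all_classical all_reals all_analysis.

Set Implicit Arguments.
Unset Strict Implicit.
Unset Printing Implicit Defensive.

Import Order.TTheory GRing.Theory Num.Theory.
Import numFieldNormedType.Exports.

Local Open Scope classical_set_scope.
Local Open Scope ring_scope.

Section Pierce.
Variable R : realType.

Definition pierce_d1 (x : R) : int := Num.floor (1 / x).

Definition pierce_T (x : R) : R := 1 - (pierce_d1 x)%:~R * x.

(* Indexed from 1. The value is a genuine Pierce digit only for 1 <= k and
   iter k.-1 pierce_T x != 0; for irrational x in (0,1] this is every k >= 1. *)
Definition pierce_digit (k : nat) (x : R) : int :=
  pierce_d1 (iter k.-1 pierce_T x).

(* Irrationality is explicit: a rational x has only finitely many digits, so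
   limiting conditions on the digits exclude it. *)
Definition pierce_ratio_set (alpha : \bar R) : set R :=
  [set x | [/\ 0 < x <= 1, irrational x &
    ((pierce_digit n.+1 x)%:~R / (pierce_digit n x)%:~R)%:E
      @[n --> \oo] --> alpha]].

End Pierce.

Section Hausdorff.
Variable R : realType.
Local Open Scope ereal_scope.

(* The empty set gets diameter -oo. *)
Definition ediam (A : set R) : \bar R :=
  ereal_sup [set z | exists x y, [/\ A x, A y & z = `|x - y|%:E]].

(* diam(A)^s, with value 0 at the empty set even for s = 0, and 0^0 = 1 at a
   singleton, so that the measure of exponent 0 is the counting measure. *)
Definition diam_pow (s : R) (A : set R) : \bar R :=
  if A == set0 then 0 else ediam A `^ s.

Definition hausdorff_premeasure (s delta : R) (A : set R) : \bar R :=
  ereal_inf [set \sum_(0 <= k <oo) diam_pow s (U k) | U in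
    [set U : nat -> set R |
      A `<=` \bigcup_k U k /\ forall k, ediam (U k) <= delta%:E]].

(* The supremum over delta > 0 is the limit as delta tends to 0, by
   monotonicity in delta. *)
Definition hausdorff_measure (s : R) (A : set R) : \bar R :=
  ereal_sup [set hausdorff_premeasure s delta A | delta in
    [set delta : R | (0 < delta)%R]].

Definition hausdorff_dim (A : set R) : \bar R :=
  ereal_inf [set s%:E | s in
    [set s : R | (0 <= s)%R /\ hausdorff_measure s A = 0]].

End Hausdorff.

(* Main.v *)
Require Import Defs.
From HB Require Import structures.
From mathcomp Require Import all_boot all_order all_algebra.
From mathcomp Require Import all_classical all_reals all_analysis.
From mathcomp Require Import ring lra zify.

Set Implicit Arguments.
Unset Strict Implicit.
Unset Printing Implicit Defensive.

Import Order.TTheory GRing.Theory Num.Theory.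
Import numFieldNormedType.Exports.

Local Open Scope classical_set_scope.
Local Open Scope ring_scope.

(** The digit sequence [d_1 < d_2 < ...] of an irrational number is strictly
    increasing, so a limit of the ratios is at least one and the sets are
    empty for [alpha < 1]. They lie in the unit interval, hence have dimension
    at most one. The content is the lower bound: for every [s < 1] the set for
    [alpha >= 1] has nonzero measure of exponent [s].

    A cylinder, the set of numbers with given first digits [d_1, ..., d_n],
    has length about [1 / (d_1 ... d_n * d_n)], because the [n]-th iterate of
    the Pierce map is affine on it with slope [d_1 ... d_n] in absolute value
    ([pierce_value_dist_prefix]). Let [u] be a positive sequence whose ratios
    of consecutive terms tend to [alpha], and restrict the digit of index [m]
    to an interval of about [u m / m] integers starting at [u m]. Digits thus
    restricted are equivalent to [u m], so their ratios tend to [alpha]. With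
    [b_m] choices for the digit of index [m], there are [b_1 ... b_n]
    cylinders, and nonzero measure of exponent [s] comes down to
    [(d_1 ... d_n * d_n) ^ s <= C * b_1 ... b_n]. This holds as soon as [m] and
    powers of [u m.+1 / u m] are small compared with [u m ^ (1 - s)]
    ([growth_measure_neq0]). Suitable sequences are
    [alpha ^ m * m ^ p] with [p] large depending on [s] when [alpha] is
    finite, and [2 ^ (m ^ 2)] when it is infinite. It is harmless that the
    restricted set depends on [s].

    No measure is built on the restricted set. Reading the digits of a number
    [0 <= y < 1] in the variable base [b] as positions inside the intervals of
    allowed Pierce digits maps the unit interval into it, and the inverse of
    this map is Hoelder continuous of exponent [s]
    ([restricted_digits_measure_neq0]). Countable subadditivity of Lebesgue
    measure on the unit interval then bounds every covering sum from below
    ([hausdorff_measure_neq0]). *)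

(** * Hausdorff dimension of subsets of the line *)

Section HausdorffBounds.
Variable R : realType.
Implicit Types (s : R) (A U : set R).

Lemma diam_pow_ge0 s U : (0 <= diam_pow s U)%E.
Proof. by rewrite /diam_pow; case: ifP => // _; exact: poweR_ge0. Qed.

Lemma hausdorff_measure_ge0 s A : (0 <= hausdorff_measure s A)%E.
Proof.
apply: (@le_trans _ _ (hausdorff_premeasure s 1 A)).
  apply: le_ereal_inf_tmp => _ [U _ <-].
  by apply: nneseries_ge0 => k _ _; exact: diam_pow_ge0.
by apply: ereal_sup_ubound; exists 1 => //; exact: ltr01.
Qed.

Lemma hausdorff_dim_ge0 A : (0 <= hausdorff_dim A)%E.
Proof. by apply: le_ereal_inf_tmp => _ [s [s0 _] <-]; rewrite lee_fin. Qed.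

Lemma ediam_set0 : ediam (@set0 R) = -oo%E.
Proof.
rewrite /ediam -[RHS]ereal_sup0; congr ereal_sup.
by apply/seteqP; split => [z [x [y []]]|].
Qed.

Lemma hausdorff_dim_set0 : hausdorff_dim (@set0 R) = 0%E.
Proof.
apply/eqP; rewrite eq_le hausdorff_dim_ge0 andbT.
apply: ereal_inf_lbound; exists 0 => //; split => //.
apply/eqP; rewrite eq_le hausdorff_measure_ge0 andbT.
apply: ge_ereal_sup => _ [delta _ <-].
apply: ereal_inf_lbound; exists (fun=> set0).
  by split=> [x []|k]; rewrite ediam_set0 leNye.
by apply: eseries0 => k _ _; rewrite /diam_pow eqxx.
Qed.

(** A cover of [A] pulls back along [g] to a cover of the unit interval, and
    the inequality bounds the length of each piece by a multiple of
    [diam_pow s]; these lengths add up to at least one. So [g] plays the part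
    of the mass distribution usually put on the set. *)
Lemma hausdorff_measure_neq0 (s C : R) A (g : R -> R) : 0 <= s -> 0 < C ->
  (forall y : R, 0 <= y < 1 -> A (g y)) ->
  (forall y z : R, 0 <= y < 1 -> 0 <= z < 1 ->
     `|y - z| <= C * `|g y - g z| `^ s) ->
  hausdorff_measure s A != 0%E.
Proof.
move=> s0 /[dup] Cgt /ltW C0 gA gC.
have key (U : nat -> set R) :
  A `<=` \bigcup_k U k -> (forall k, (ediam (U k) <= 1)%E) ->
  (1 <= (2 * C)%:E * \sum_(0 <= k <oo) diam_pow s (U k))%E.
  move=> AU dU.
  have piece k : exists I : set R, [/\ measurable I,
      (forall y : R, 0 <= y < 1 -> U k (g y) -> I y) &
      (lebesgue_measure I <= (2 * C)%:E * diam_pow s (U k))%E].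
    have [[y0 [y01 Uy0]]|nV] :=
      pselect (exists y : R, 0 <= y < 1 /\ U k (g y)); last first.
      exists set0; split => //.
        by move=> y y01 Uy; case: nV; exists y.
      by rewrite measure0 mule_ge0 ?diam_pow_ge0 // lee_fin mulr_ge0.
    have dge (y z : R) : U k y -> U k z -> (`|y - z|%:E <= ediam (U k))%E.
      by move=> Uy Uz; apply: ereal_sup_ubound; exists y, z.
    have d0 := dge _ _ Uy0 Uy0; rewrite subrr normr0 in d0.
    have dfin : ediam (U k) \is a fin_num.
      by apply/fin_numP; split; apply/eqP => dE; have := dU k; move: d0; rewrite dE.
    pose D := fine (ediam (U k)).
    have dE : ediam (U k) = D%:E by rewrite fineK.
    have D0 : 0 <= D by rewrite -lee_fin -dE.
    have Dge (y z : R) : U k y -> U k z -> `|y - z| <= D.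
      by move=> Uy Uz; rewrite -lee_fin -dE dge.
    have E0 : 0 <= C * D `^ s by rewrite mulr_ge0 // powR_ge0.
    exists `[y0 - C * D `^ s, y0 + C * D `^ s]%classic; split.
    - exact: measurable_itv.
    - move=> y y01' Uy /=; rewrite in_itv /=.
      have h : `|y - y0| <= C * D `^ s.
        apply: le_trans (gC _ _ y01' y01) _; rewrite ler_wpM2l //.
        by apply: ge0_ler_powR => //; rewrite ?nnegrE ?normr_ge0 ?Dge.
      by move: h; rewrite ler_norml; lra.
    - rewrite /diam_pow; case: ifP => [/eqP U0|_]; first by move: Uy0; rewrite U0.
      rewrite dE poweR_EFin lebesgue_measure_itv /= lte_fin.
      case: ifP => _; last by rewrite -EFinM lee_fin -mulrA mulr_ge0.
      by rewrite -EFinB -EFinM lee_fin; lra.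
  have [I HI] := choice piece.
  have h : (lebesgue_measure (`[0%R, 1%R[%classic : set R) <=
            \sum_(0 <= n <oo) lebesgue_measure (I n))%E.
    apply: measure_sigma_subadditive => [n||].
    - by have [] := HI n.
    - exact: measurable_itv.
    - move=> y /=; rewrite in_itv /= => y01.
      have [k _ Uk] := AU _ (gA _ y01).
      by exists k => //; have [_ + _] := HI k; apply.
  rewrite lebesgue_measure_itv /= lte_fin ltr01 -EFinB subr0 in h.
  apply: le_trans h _.
  rewrite -nneseriesZl; last by move=> *; exact: diam_pow_ge0.
  by apply: lee_nneseries => k; have [] := HI k.
have Cgt0 : 0 < 2 * C by rewrite mulr_gt0.
rewrite gt_eqF //; apply: (@lt_le_trans _ _ (((2 * C)^-1)%:E)).
  by rewrite lte_fin invr_gt0.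
apply: (@le_trans _ _ (hausdorff_premeasure s 1 A)); last first.
  by apply: ereal_sup_ubound; exists 1 => //; exact: ltr01.
apply: le_ereal_inf_tmp => _ [U [AU dU] <-].
have h := key U AU dU.
rewrite -(@lee_pmul2l _ (2 * C)%:E) ?fin_numE // -?EFinM ?divff ?gt_eqF //.
Qed.

(** At exponents above one, equal subdivisions of the unit interval already
    have arbitrarily small covering sums. *)
Lemma hausdorff_measure_unit_itv (s : R) A : 1 < s ->
  A `<=` `[0, 1]%classic -> hausdorff_measure s A = 0%E.
Proof.
move=> s1 A01; apply/eqP; rewrite eq_le hausdorff_measure_ge0 andbT.
apply: ge_ereal_sup => _ [delta /= delta0 <-].
apply/lee_addgt0Pr => e e0; rewrite add0e.
(* [n] intervals of length [1 / n] contribute [n `^ (1 - s)], which is at most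
   [e] once [n] is at least [(1 / e) `^ (1 / (s - 1))]. *)
pose n := (Num.truncn (Num.max delta^-1 (e^-1 `^ (s - 1)^-1))).+1.
have ngt : Num.max delta^-1 (e^-1 `^ (s - 1)^-1) < n%:R.
  by have /truncn_itv/andP[] : 0 <= Num.max delta^-1 (e^-1 `^ (s - 1)^-1)
    by rewrite le_max invr_ge0 (ltW delta0).
have n0 : (0 : R) < n%:R by rewrite ltr0n.
pose U k : set R :=
  if (k < n)%N then `[k%:R / n%:R, k.+1%:R / n%:R]%classic else set0.
have dU k : (ediam (U k) <= (n%:R^-1)%:E)%E.
  rewrite /U; case: ifP => _; last by rewrite ediam_set0 leNye.
  apply: ge_ereal_sup => _ [x [y [/= + + ->]]]; rewrite !in_itv /= => hx hy.
  rewrite lee_fin ler_norml.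
  have kn : k.+1%:R / n%:R = k%:R / n%:R + n%:R^-1 :> R
    by rewrite -natr1 mulrDl mul1r.
  by rewrite kn in hx hy; lra.
have pU k : (diam_pow s (U k) <= ((n%:R^-1) `^ s)%:E)%E.
  rewrite /diam_pow; case: ifPn => [_|/set0P[x Ux]].
    by rewrite lee_fin powR_ge0.
  rewrite -poweR_EFin; apply: gt0_ler_poweR; rewrite ?dU //; first by lra.
    rewrite in_itv /= leey andbT; apply: ereal_sup_ubound; exists x, x.
    by split => //; rewrite subrr normr0.
  by rewrite in_itv /= leey andbT lee_fin invr_ge0 ltW.
apply: (@le_trans _ _ (\sum_(0 <= k <oo) diam_pow s (U k))%E).
  apply: ereal_inf_lbound; exists U => //; split.
    move=> x /A01 /=; rewrite in_itv /= => /andP[x0 x1].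
    have [xE|xn1] := eqVneq x 1.
      exists n.-1 => //; rewrite /U /= ltnS leqnn /= in_itv /= xE divff ?gt_eqF //.
      by rewrite lexx andbT ler_pdivrMr // mul1r ler_nat.
    have xn0 : 0 <= x * n%:R by rewrite mulr_ge0 // ltW.
    have /andP[h1 h2] := truncn_itv xn0.
    exists (Num.truncn (x * n%:R)) => //; rewrite /U.
    have -> : (Num.truncn (x * n%:R) < n)%N.
      rewrite truncn_lt_nat // -[ltRHS]mul1r ltr_pM2r // lt_neqAle xn1 //.
    by rewrite /= in_itv /= ler_pdivrMr // h1 ler_pdivlMr // ltW.
  move=> k; apply: le_trans (dU k) _; rewrite lee_fin.
  rewrite -[leRHS]invrK lef_pV2 ?posrE ?invr_gt0 //.
  by apply: ltW; apply: le_lt_trans ngt; rewrite le_max lexx.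
rewrite (nneseries_split 0 n) ?add0n; last by move=> *; exact: diam_pow_ge0.
rewrite (@eseries0 _ _ n); last first.
  by move=> k nk _; rewrite /U ltnNge nk /diam_pow eqxx.
rewrite adde0.
apply: (@le_trans _ _ (\sum_(0 <= k < n) ((n%:R^-1) `^ s)%:E)%E).
  by apply: lee_sum => k _; exact: pU.
rewrite sumEFin lee_fin big_const_nat subn0 iter_addr_0 -[leLHS]mulr_natr.
have E : (n%:R^-1) `^ s * n%:R = (n%:R `^ (s - 1))^-1 :> R.
  rewrite -powR_inv1 ?ltW // -powRrM -[X in _ * X](@powRr1 _ n%:R) ?ltW //.
  rewrite -powRD; last by rewrite (gt_eqF n0) implybT.
  by rewrite -powRN; congr powR; ring.
rewrite E -[leRHS]invrK lef_pV2 ?posrE ?invr_gt0 ?powR_gt0 //.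
have /ltW h : e^-1 `^ (s - 1)^-1 < n%:R.
  by apply: le_lt_trans ngt; rewrite le_max lexx orbT.
have s10 : 0 < s - 1 by lra.
apply: le_trans (ge0_ler_powR (ltW s10) _ _ h); rewrite ?nnegrE ?powR_ge0 //.
by rewrite -powRrM mulVf ?gt_eqF // powRr1 // invr_ge0 ltW.
Qed.

Lemma hausdorff_dim_le1 A : A `<=` `[0, 1]%classic -> (hausdorff_dim A <= 1)%E.
Proof.
move=> A01; apply/lee_addgt0Pr => e e0; apply: ereal_inf_lbound.
exists (1 + e); last by rewrite EFinD.
by split; [lra|apply: hausdorff_measure_unit_itv => //; lra].
Qed.

Lemma hausdorff_dim_ge1 A :
  (forall s : R, 0 <= s < 1 -> hausdorff_measure s A != 0%E) ->
  (1 <= hausdorff_dim A)%E.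
Proof.
move=> As; apply: le_ereal_inf_tmp => _ [s [s0 sA] <-].
rewrite lee_fin leNgt; apply/negP => s1.
by have := As s; rewrite s0 s1 sA eqxx => /(_ isT).
Qed.

End HausdorffBounds.

(** * Numbers with prescribed Pierce digits *)

Definition drop_digit (d : nat -> nat) : nat -> nat := fun n => d n.+1.

Definition admissible (d : nat -> nat) : Prop :=
  (0 < d 0)%N /\ forall n, (d n < d n.+1)%N.

Lemma admissible_shift d : admissible d -> admissible (drop_digit d).
Proof. by move=> [d0 dS]; split => [|n]; [exact: leq_trans (dS 0%N)|exact: dS]. Qed.

Lemma admissible_gt0 d n : admissible d -> (0 < d n)%N.
Proof. by move=> [d0 dS]; elim: n => // n _; exact: leq_trans (dS n). Qed.

Section PierceValue.
Variable R : realType.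
Implicit Types d : nat -> nat.

Definition pierce_term d (k : nat) : R :=
  (-1) ^+ k / (\prod_(i < k.+1) d i)%:R.

Definition pierce_value d : R := limn (series (pierce_term d)).

Lemma pierce_partial_sumS d n :
  series (pierce_term d) n.+1 =
  (1 - series (pierce_term (drop_digit d)) n) / (d 0)%:R.
Proof.
rewrite /series /= big_nat_recl // mulrBl -mulNr -sumrN big_distrl /=.
congr (_ + _); first by rewrite /pierce_term big_ord1 expr0.
apply: eq_bigr => k _.
rewrite /pierce_term big_ord_recl natrM invfM exprS mulN1r !mulNr.
by rewrite [(d 0)%:R^-1 * _]mulrC mulrA.
Qed.

Lemma pierce_series_cvg d : admissible d -> cvgn (series (pierce_term d)).
Proof.
move=> dd; apply: normed_cvg.
have half1 : `|2^-1 : R| < 1 by rewrite ger0_norm; lra.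
apply: series_le_cvg (@is_cvg_geometric_series _ 1 2^-1 half1) => [n|n|n] /=.
- exact: normr_ge0.
- by rewrite mul1r exprn_ge0 //; lra.
rewrite mul1r /pierce_term normrM normrX normrN1 expr1n mul1r normfV normr_nat.
have h : (2 ^ n <= \prod_(i < n.+1) d i)%N.
  rewrite big_ord_recl -[leqLHS]mul1n leq_mul ?(admissible_gt0 0) //.
  rewrite -[leqLHS]mul1n mul1n -[X in (_ ^ X)%N]card_ord -prod_nat_const.
  apply: leq_prod => i _; apply: leq_ltn_trans (dd.2 _).
  exact: admissible_gt0.
rewrite exprVn lef_pV2 ?posrE ?exprn_gt0 ?ltr0n //; last first.
  by apply: leq_trans h; rewrite expn_gt0.
by rewrite -natrX ler_nat.
Qed.

(** The partial sums obey this recursion with one term of delay, so the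
    limit obeys it: the Pierce map undoes the first digit. *)
Lemma pierce_value_rec d : admissible d ->
  pierce_value d = (1 - pierce_value (drop_digit d)) / (d 0)%:R.
Proof.
move=> dd; have cd := pierce_series_cvg dd.
have cs := pierce_series_cvg (admissible_shift dd).
have h : series (pierce_term d) n.+1 @[n --> \oo] -->
    (1 - pierce_value (drop_digit d)) / (d 0)%:R.
  rewrite (_ : (fun n => _) = (fun n =>
      (1 - series (pierce_term (drop_digit d)) n) / (d 0)%:R)).
    by apply: cvgMr_tmp; apply: cvgB => //; exact: cvg_cst.
  by apply/funext => n; rewrite pierce_partial_sumS.
have h2 : series (pierce_term d) n.+1 @[n --> \oo] --> pierce_value d.
  by rewrite (cvg_shiftS (series (pierce_term d))).
exact: (cvg_unique _ h2 h).
Qed.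

Lemma pierce_partial_sum_itv d n : admissible d ->
  0 <= series (pierce_term d) n <= (d 0)%:R^-1.
Proof.
elim: n d => [d dd|n IH d dd].
  by rewrite /series /= big_geq // lexx invr_ge0 ler0n.
have d0 : (0 : R) < (d 0)%:R by rewrite ltr0n admissible_gt0.
have d1 : (1 : R) <= (drop_digit d 0)%:R
  by rewrite ler1n admissible_gt0 //; exact: admissible_shift.
have /andP[h1 h2] := IH _ (admissible_shift dd).
have {}h2 : series (pierce_term (drop_digit d)) n <= 1.
  by apply: le_trans h2 _; rewrite invf_le1 // (lt_le_trans ltr01).
rewrite pierce_partial_sumS; apply/andP; split.
  by rewrite divr_ge0 ?subr_ge0 ?ler0n.
by rewrite ler_pdivrMr // mulVf ?gt_eqF //; lra.
Qed.

Lemma pierce_value_weak_itv d : admissible d ->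
  0 <= pierce_value d <= (d 0)%:R^-1.
Proof.
move=> dd; have h n := pierce_partial_sum_itv n dd.
apply/andP; split.
  apply: limr_ge; first exact: pierce_series_cvg.
  by near=> n; have /andP[] := h n.
apply: limr_le; first exact: pierce_series_cvg.
by near=> n; have /andP[] := h n.
Unshelve. all: by end_near. Qed.

Lemma pierce_value_gt0 d : admissible d -> 0 < pierce_value d.
Proof.
move=> dd; have d0 : (0 : R) < (d 0)%:R by rewrite ltr0n admissible_gt0.
rewrite pierce_value_rec // divr_gt0 // subr_gt0.
have /andP[_ h] := pierce_value_weak_itv (admissible_shift dd).
apply: le_lt_trans h _; rewrite invf_lt1 ?ltr1n ?ltr0n ?admissible_gt0 //.
  by apply: leq_ltn_trans (dd.2 0%N); case: dd.
exact: admissible_shift.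
Qed.

Lemma pierce_value_lt d : admissible d -> pierce_value d < (d 0)%:R^-1.
Proof.
move=> dd; have d0 : (0 : R) < (d 0)%:R by rewrite ltr0n admissible_gt0.
rewrite pierce_value_rec // ltr_pdivrMr // mulVf ?gt_eqF //.
by rewrite ltrBlDr ltrDl; apply: pierce_value_gt0; exact: admissible_shift.
Qed.

(** The value is [(1 - y) / d 0] with [y < 1 / d 1], so a large [d 1] keeps it
    away from the left end of the cylinder of [d 0]. Taking [m = 1] gives the
    cylinder itself; [m = 2] leaves a gap to the next one. *)
Lemma pierce_value_gt d m : admissible d -> (d 0 + m <= d 1)%N -> (0 < m)%N ->
  (1 - (d 0 + m)%:R^-1) / (d 0)%:R < pierce_value d.
Proof.
move=> dd dm m0; have d0 : (0 : R) < (d 0)%:R by rewrite ltr0n admissible_gt0.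
rewrite [ltRHS]pierce_value_rec // ltr_pM2r ?invr_gt0 //.
rewrite ltrD2l ltrN2; apply: lt_le_trans (pierce_value_lt (admissible_shift dd)) _.
rewrite lef_pV2 ?posrE ?ltr0n ?addn_gt0 ?m0 ?orbT ?ler_nat //.
by apply: admissible_gt0; exact: admissible_shift.
Qed.

Lemma pierce_value_itv d : admissible d ->
  (d 0).+1%:R^-1 < pierce_value d < (d 0)%:R^-1.
Proof.
move=> dd; rewrite pierce_value_lt // andbT.
have h : (d 0 + 1 <= d 1)%N by rewrite addn1; case: dd.
apply: le_lt_trans (pierce_value_gt dd h isT).
have d0 : (0 : R) < (d 0)%:R by rewrite ltr0n admissible_gt0.
rewrite addn1 -natr1 le_eqVlt; apply/orP; left; apply/eqP; field.
by rewrite !gt_eqF //; lra.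
Qed.

Lemma pierce_d1_value d : admissible d -> pierce_d1 (pierce_value d) = (d 0)%:Z.
Proof.
move=> dd; apply: floor_def; rewrite div1r.
have d0 : (0 : R) < (d 0)%:R by rewrite ltr0n admissible_gt0.
have x0 := pierce_value_gt0 dd; have /andP[h1 h2] := pierce_value_itv dd.
rewrite (_ : (d 0)%:Z + 1 = (d 0).+1%:Z); last by rewrite -addn1.
rewrite -!pmulrn; apply/andP; split.
  by rewrite -[leLHS]invrK lef_pV2 ?posrE ?invr_gt0 // ltW.
by rewrite -[ltRHS]invrK ltf_pV2 ?posrE ?invr_gt0 ?ltr0n.
Qed.

Lemma pierce_T_value d : admissible d ->
  pierce_T (pierce_value d) = pierce_value (drop_digit d).
Proof.
move=> dd; rewrite /pierce_T pierce_d1_value // -pmulrn pierce_value_rec //.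
rewrite mulrC divfK; first by ring.
by rewrite gt_eqF // ltr0n; case: dd.
Qed.

Lemma admissible_iter_shift d n : admissible d -> admissible (iter n drop_digit d).
Proof. by move=> dd; elim: n => //= n; exact: admissible_shift. Qed.

Lemma iter_shiftE d n k : iter n drop_digit d k = d (n + k)%N.
Proof. by elim: n k => // n IH k; rewrite iterS /drop_digit IH addSnnS. Qed.

Lemma iter_pierce_T_value d n : admissible d ->
  iter n (@pierce_T R) (pierce_value d) = pierce_value (iter n drop_digit d).
Proof.
move=> dd; elim: n => //= n ->.
by rewrite pierce_T_value //; exact: admissible_iter_shift.
Qed.

Lemma pierce_digit_value d n : admissible d ->
  pierce_digit n.+1 (pierce_value d) = (d n)%:Z.
Proof.
move=> dd; rewrite /pierce_digit iter_pierce_T_value // pierce_d1_value.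
  by rewrite iter_shiftE addn0.
exact: admissible_iter_shift.
Qed.

(** On a rational number the Pierce map decreases the numerator, so it
    cannot be iterated for ever without meeting zero. *)
Lemma pierce_value_irrational d : admissible d -> irrational (pierce_value d).
Proof.
move=> dd [r _ rE].
have r0 : 0 < r by rewrite -(ltr0q R) rE; exact: pierce_value_gt0.
have [q [q0 [m mE]]] : exists q : nat, (0 < q)%N /\ exists m : nat,
    pierce_value d * q%:R = m%:R.
  exists `|denq r|%N; split; first by rewrite absz_gt0 denq_neq0.
  exists `|numq r|%N; rewrite -rE.
  rewrite !pmulrn !gez0_abs ?ltW ?denq_gt0 ?numq_gt0 //.
  rewrite -(ratr_int R (denq r)) -(ratr_int R (numq r)) -rmorphM; congr ratr.
  by rewrite -{1}(divq_num_den r) divfK // intr_eq0 denq_neq0.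
elim/ltn_ind: m d dd mE {rE r0 r} => m IH d dd mE.
have x0 := pierce_value_gt0 dd; have ds := admissible_shift dd.
have y0 := pierce_value_gt0 ds.
have q0R : (0 : R) < q%:R by rewrite ltr0n.
have d0 : (0 : R) < (d 0)%:R by rewrite ltr0n admissible_gt0.
have yE : pierce_value (drop_digit d) * q%:R = q%:R - (d 0 * m)%:R.
  by rewrite natrM -mE (pierce_value_rec dd); field; rewrite gt_eqF.
have le1 : (d 0 * m <= q)%N.
  by rewrite -(ler_nat R) -subr_ge0 -yE mulr_ge0 // ltW.
apply: (IH (q - d 0 * m)%N _ _ ds); last by rewrite yE natrB.
(* The new numerator [q * pierce_value (drop_digit d)] is at most [m] because
   [pierce_value (drop_digit d) < 1 / (d 0 + 1) < pierce_value d]. *)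
rewrite -(ltr_nat R) natrB // -yE -mE ltr_pM2r //.
have /andP[h1 _] := pierce_value_itv dd; apply: lt_trans h1.
apply: lt_le_trans (pierce_value_lt ds) _.
rewrite lef_pV2 ?posrE ?ltr0n ?ler_nat //; first by case: dd.
exact: admissible_gt0.
Qed.

(** Dropping a common first digit [d 0] multiplies differences by [- d 0]. *)
Lemma pierce_value_dist_prefix d e n : admissible d -> admissible e ->
  (forall k, (k < n)%N -> d k = e k) ->
  `|pierce_value d - pierce_value e| =
  `|pierce_value (iter n drop_digit d) - pierce_value (iter n drop_digit e)| /
    (\prod_(k < n) d k)%:R.
Proof.
elim: n d e => [|n IH] d e dd de dE.
  by rewrite big_ord0 divr1.
have dd' := admissible_shift dd; have de' := admissible_shift de.
rewrite pierce_value_rec // (pierce_value_rec de) -(dE 0%N) // -mulrBl.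
rewrite normrM normfV normr_nat distrC opprB addrC subrKA.
rewrite (IH (drop_digit d)) //; last by move=> k kn; exact: dE.
by rewrite !iterSr big_ord_recl natrM invfM mulrA mulrAC.
Qed.

(** Without the hypothesis on [d 1] the two values could be arbitrarily close
    to the common end of adjacent cylinders. The cube comes from
    [(1 - 1 / (t + 2)) / t - 1 / (t + 1) = 1 / (t * (t + 1) * (t + 2))]. *)
Lemma pierce_value_gap d e : admissible d -> admissible e ->
  (d 0 < e 0)%N -> (d 0 + 2 <= d 1)%N ->
  ((d 0 + 2) ^ 3)%:R^-1 <= pierce_value d - pierce_value e.
Proof.
move=> dd de d0e d2.
have d0 : (1 : R) <= (d 0)%:R by rewrite ler1n admissible_gt0.
have h1 := pierce_value_gt dd d2 isT.
have h2 := pierce_value_lt de.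
have h3 : (e 0)%:R^-1 <= ((d 0)%:R + 1)^-1 :> R.
  by rewrite lef_pV2 ?posrE ?natr1 ?ler_nat ?ltr0n //; exact: leq_ltn_trans d0e.
rewrite natrX natrD.
move: h1 h2 h3; rewrite natrD; move: d0; set t : R := (d 0)%:R => t1 h1 h2 h3.
have h4 : (1 - (t + 2)^-1) / t - (t + 1)^-1 = (t * (t + 1) * (t + 2))^-1.
  by field; rewrite !gt_eqF //; lra.
have h5 : ((t + 2) ^+ 3)^-1 <= (t * (t + 1) * (t + 2))^-1.
  rewrite lef_pV2 ?posrE; [nra|apply: exprn_gt0; lra|].
  by rewrite !mulr_gt0 //; lra.
by lra.
Qed.

End PierceValue.

(** * Expansions in a variable base *)

Section MixedRadix.
Variables (R : realType) (b : nat -> nat).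
Hypothesis b_gt1 : forall n, (1 < b n)%N.
Implicit Types y z : R.

Fixpoint radix_rem (y : R) (n : nat) : R :=
  if n is m.+1 then
    (b m)%:R * radix_rem y m - (Num.truncn ((b m)%:R * radix_rem y m))%:R
  else y.

Definition radix_digit (y : R) (n : nat) : nat :=
  Num.truncn ((b n)%:R * radix_rem y n).

Lemma radix_rem_itv y n : 0 <= y < 1 -> 0 <= radix_rem y n < 1.
Proof.
move=> y01; elim: n => //= n /andP[r0 r1].
have /truncn_itv/andP[h1 h2] : 0 <= (b n)%:R * radix_rem y n by rewrite mulr_ge0.
by rewrite subr_ge0 h1 ltrBlDr addrC natr1.
Qed.

Lemma radix_digit_lt y n : 0 <= y < 1 -> (radix_digit y n < b n)%N.
Proof.
move=> /(radix_rem_itv n)/andP[r0 r1].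
rewrite /radix_digit truncn_lt_nat ?mulr_ge0 // -[ltRHS]mulr1 ltr_pM2l //.
by rewrite ltr0n ltnW.
Qed.

Lemma radix_rem_prefix y z n :
  (forall k, (k < n)%N -> radix_digit y k = radix_digit z k) ->
  radix_rem y n - radix_rem z n = (y - z) * (\prod_(k < n) b k)%:R.
Proof.
elim: n => [|n IH] E; first by rewrite big_ord0 mulr1.
have En := E n (ltnSn n); rewrite /radix_digit in En.
rewrite /= En opprB addrA subrK big_ord_recr natrM /= mulrA -IH.
  by rewrite -mulrBr mulrC.
by move=> k kn; apply: E; exact: ltnW.
Qed.

Lemma radix_dist_prefix y z n : 0 <= y < 1 -> 0 <= z < 1 ->
  (forall k, (k < n)%N -> radix_digit y k = radix_digit z k) ->
  `|y - z| <= (\prod_(k < n) b k)%:R^-1.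
Proof.
move=> y01 z01 /radix_rem_prefix E.
have p0 : 0 < (\prod_(k < n) b k)%:R :> R.
  by rewrite ltr0n prodn_gt0 // => k; rewrite ltnW.
rewrite -[leRHS]mul1r ler_pdivlMr // -[X in _ * X]gtr0_norm // -normrM -E.
by have := radix_rem_itv n y01; have := radix_rem_itv n z01; rewrite ler_norml; lra.
Qed.

(** Two numbers with the same digits coincide because every base is at least
    two, which makes the bound of [radix_dist_prefix] tend to zero. *)
Lemma radix_first_difference y z : 0 <= y < 1 -> 0 <= z < 1 -> y != z ->
  exists2 n, radix_digit y n != radix_digit z n &
    forall k, (k < n)%N -> radix_digit y k = radix_digit z k.
Proof.
move=> y01 z01 yz.
have [E|] := pselect (exists n, radix_digit y n != radix_digit z n).
  exists (ex_minn E); case: ex_minnP => // m _ mn k km.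
  by apply/eqP; apply: contraTT km => /mn; rewrite -leqNgt.
move=> nE; exfalso; have E k : radix_digit y k = radix_digit z k.
  by apply/eqP; apply/negPn/negP => h; apply: nE; exists k.
have d0 : 0 < `|y - z| by rewrite normr_gt0 subr_eq0.
pose n := (Num.truncn `|y - z|^-1).+1.
have /truncn_itv/andP[_ nlt] : 0 <= `|y - z|^-1 by rewrite invr_ge0.
have := radix_dist_prefix (n := n) y01 z01 (fun k _ => E k).
have p0 : (n <= \prod_(k < n) b k)%N.
  apply: leq_trans (ltnW (ltn_expl n (ltnSn 1))) _.
  rewrite -[X in (_ ^ X <= _)%N]card_ord -prod_nat_const.
  by apply: leq_prod => i _; exact: b_gt1.
move=> h; have := lt_le_trans nlt (_ : n%:R <= (\prod_(k < n) b k)%:R).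
rewrite ler_nat => /(_ p0).
rewrite -[X in _ < X -> _]invrK ltf_pV2 ?posrE ?invr_gt0 //.
  by rewrite ltNge h.
by rewrite ltr0n (leq_trans _ p0).
Qed.

End MixedRadix.

(** * Sets of numbers with restricted digits *)

Section RestrictedDigits.
Variables (R : realType) (a b : nat -> nat) (s : R).
Hypotheses (s_ge0 : 0 <= s) (a0_gt0 : (0 < a 0)%N).
Hypothesis b_gt1 : forall n, (1 < b n)%N.
Hypothesis top_lt : forall n, (a n + b n < a n.+1)%N.
Hypothesis b_large : forall n,
  ((a n.+1 + b n.+1)%:R ^+ 3 / (a n + b n)%:R ^+ 2) `^ s <= (b n)%:R :> R.

Let top n : nat := (a n + b n)%N.

Let digits (y : R) : nat -> nat := fun n => (a n + radix_digit b y n)%N.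

Let digits_lt_top (y : R) n : 0 <= y < 1 -> (digits y n < top n)%N.
Proof. by move=> y01; rewrite ltn_add2l radix_digit_lt. Qed.

Let digits_gap (y : R) n : 0 <= y < 1 -> (digits y n + 2 <= digits y n.+1)%N.
Proof.
move=> y01; rewrite addn2; apply: leq_ltn_trans (digits_lt_top n y01) _.
exact: leq_trans (top_lt n) (leq_addr _ _).
Qed.

Let digits_admissible (y : R) : 0 <= y < 1 -> admissible (digits y).
Proof.
move=> y01; split; first by rewrite addn_gt0 a0_gt0.
by move=> n; apply: leq_trans (digits_gap n y01); rewrite addn2 ltnS leqnSn.
Qed.

(** [sep n] is the inverse of a lower bound for the distance between numbers
    whose digits first differ at index [n]. *)
Let sep n : R := (\prod_(k < n) top k)%:R * (top n)%:R ^+ 3.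

Let top_gt0 n : 0 < (top n)%:R :> R.
Proof. by rewrite ltr0n addn_gt0 (ltnW (b_gt1 n)) orbT. Qed.

Let prod_top_gt0 n : 0 < (\prod_(k < n) top k)%:R :> R.
Proof. by rewrite natr_prod prodr_gt0. Qed.

Let sep_gt0 n : 0 < sep n.
Proof. by rewrite mulr_gt0 // exprn_gt0. Qed.

(** By induction: [sep n.+1 / sep n] is exactly the quantity whose power is
    bounded in [b_large]. *)
Let sep_powR n : sep n `^ s <= sep 0 `^ s * (\prod_(k < n) b k)%:R.
Proof.
elim: n => [|n IH]; first by rewrite big_ord0 mulr1.
rewrite big_ord_recr natrM mulrA.
have -> : sep n.+1 = sep n * ((top n.+1)%:R ^+ 3 / (top n)%:R ^+ 2).
  rewrite /sep big_ord_recr natrM /=; field.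
  by rewrite gt_eqF.
rewrite powRM ?divr_ge0 ?exprn_ge0 //; last exact: ltW.
by apply: ler_pM IH (b_large n); exact: powR_ge0.
Qed.

Let digits_separated (y z : R) n : 0 <= y < 1 -> 0 <= z < 1 ->
  (digits y n < digits z n)%N ->
  (forall k, (k < n)%N -> digits y k = digits z k) ->
  (sep n)^-1 <= `|pierce_value R (digits y) - pierce_value R (digits z)|.
Proof.
move=> y01 z01 dn E.
have [dy dz] := (digits_admissible y01, digits_admissible z01).
rewrite (pierce_value_dist_prefix R dy dz E) /sep invfM mulrC.
have dy' := admissible_iter_shift n dy; have dz' := admissible_iter_shift n dz.
apply: ler_pM; rewrite ?invr_ge0 ?exprn_ge0 //.
  have h := @pierce_value_gap R _ _ dy' dz'; rewrite !iter_shiftE addn0 addn1 in h.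
  apply: le_trans (ler_norm _); apply: le_trans (h dn (digits_gap n y01)).
  rewrite -natrX lef_pV2 ?posrE ?ltr0n ?expn_gt0 ?addn2 //; last first.
    by rewrite -(ltr0n R) top_gt0.
  by rewrite ler_nat leq_exp2r // (leq_ltn_trans dn) // digits_lt_top.
rewrite lef_pV2 ?posrE // ?ler_nat; last first.
  by rewrite ltr0n prodn_gt0 // => k; exact: admissible_gt0.
by apply: leq_prod => k _; apply: ltnW; exact: digits_lt_top.
Qed.

(** Reading the base-[b] digits of [y] as offsets of Pierce digits from [a]
    gives a map from [[0, 1[] whose inverse is Hoelder continuous of exponent
    [s]: two points which first differ at the digit of index [n] are at
    distance at most [1 / (b 0 ... b n.-1)], and their images at distance at
    least [1 / sep n]. *)
Lemma restricted_digits_measure_neq0 (B : set R) :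
  (forall d, admissible d -> (forall n, (a n <= d n < a n + b n)%N) ->
     B (pierce_value R d)) ->
  hausdorff_measure s B != 0%E.
Proof.
move=> HB; have C0 : 0 < sep 0 `^ s by rewrite powR_gt0.
apply: (hausdorff_measure_neq0 (g := fun y => pierce_value R (digits y)) s_ge0 C0).
  move=> y y01; apply: HB; first exact: digits_admissible.
  by move=> n; rewrite leq_addr; exact: digits_lt_top.
move=> y z y01 z01.
have [->|yz] := eqVneq y z; first by rewrite subrr normr0 mulr_ge0 ?powR_ge0.
have [n nE E] := radix_first_difference b_gt1 y01 z01 yz.
have {nE} nE : digits y n != digits z n by rewrite eqn_add2l.
have E' k : (k < n)%N -> digits y k = digits z k by move=> kn; rewrite /digits E.
have dist : (sep n)^-1 <= `|pierce_value R (digits y) - pierce_value R (digits z)|.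
  move: nE; rewrite neq_ltn => /orP[lt|lt]; first exact: digits_separated.
  rewrite distrC; apply: digits_separated => // k kn; by rewrite E'.
apply: le_trans (radix_dist_prefix b_gt1 y01 z01 E) _.
have p0 : 0 < (\prod_(k < n) b k)%:R :> R.
  by rewrite ltr0n prodn_gt0 // => k; exact: ltnW.
apply: (@le_trans _ _ (sep 0 `^ s * (sep n)^-1 `^ s)); last first.
  rewrite ler_wpM2l ?powR_ge0 //; apply: ge0_ler_powR => //.
  by rewrite nnegrE invr_ge0 ltW.
have snE : (sep n)^-1 `^ s = (sep n `^ s)^-1.
  by rewrite -powR_inv1 ?ltW // powRAC powR_inv1 // powR_ge0.
rewrite snE ler_pdivlMr ?powR_gt0 // mulrC ler_pdivrMr //.
Qed.

End RestrictedDigits.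

(** * Digits following a prescribed growth *)

Section Growth.
Variable R : realType.

Lemma cvg_invn : (n%:R^-1 : R) @[n --> \oo] --> (0 : R).
Proof. by rewrite -(cvg_shiftS (fun n => n%:R^-1 : R)); exact: cvg_harmonic. Qed.

Lemma natmul_ge1 (e : R) : 0 < e -> exists2 p : nat, (0 < p)%N & 1 <= p%:R * e.
Proof.
move=> e0; exists (Num.truncn e^-1).+1 => //.
have /truncn_itv/andP[_ /ltW h] : 0 <= e^-1 by rewrite invr_ge0 ltW.
by rewrite -[leLHS](mulVf (lt0r_neq0 e0)) ler_pM2r.
Qed.

(** Saving a factor [c] costs no more than lowering the exponent from one to
    [s], once [c] is at most a [p]-th root of [z] with [1 / p <= 1 - s]. *)
Lemma powR_le_div (z c s : R) p : 1 <= z -> 0 < c -> c ^+ p <= z ->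
  1 <= p%:R * (1 - s) -> z `^ s <= z / c.
Proof.
move=> z1 c0 cz ps.
have p0 : (0 : R) < p%:R.
  rewrite ltr0n lt0n; apply/eqP => p0; move: ps; rewrite p0 mul0r; lra.
have z0 : 0 < z by lra.
have cle : c <= z `^ (p%:R^-1).
  have {1}-> : c = (c ^+ p) `^ (p%:R^-1).
    by rewrite -(powR_mulrn p (ltW c0)) -powRrM mulfV ?gt_eqF // powRr1 // ltW.
  apply: ge0_ler_powR cz;
    by rewrite ?nnegrE ?invr_ge0 ?exprn_ge0 ?(ltW c0) ?(ltW z0).
rewrite ler_pdivlMr //.
apply: le_trans (ler_wpM2l (powR_ge0 _ _) cle) _.
rewrite -powRD; last by rewrite (gt_eqF z0) implybT.
rewrite -[leRHS](powRr1 (ltW z0)); apply: ler_powR => //.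
have : p%:R^-1 <= 1 - s by rewrite -[leLHS]mul1r ler_pdivrMr // mulrC.
by lra.
Qed.

(** With [m = n + N], the digits allowed at index [n] lie between [u m] and
    [u m * (1 + 2 / m)]: this is narrow enough to make [d n] equivalent to
    [u m], yet leaves about [u m / m] choices. The second condition on [u]
    keeps the intervals of successive indices apart. The third bounds [m]
    and the ratio of consecutive terms by a [p]-th root of [u m], hence by its
    power of exponent [1 - s]: this is the room left by an exponent [s] below
    one. *)
Lemma growth_measure_neq0 (alpha : \bar R) (s : R) (p N : nat) (u : nat -> R) :
  0 <= s -> 1 <= p%:R * (1 - s) -> (0 < N)%N ->
  (forall m, (N <= m)%N ->
    [/\ 0 < u m, u m * (1 + 3 / m%:R) <= u m.+1 &
        (54 * m%:R * (u m.+1 / u m) ^+ 3) ^+ p <= u m]) ->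
  (u m.+1 / u m)%:E @[m --> \oo] --> alpha ->
  hausdorff_measure s (pierce_ratio_set alpha) != 0%E.
Proof.
move=> s0 ps N0 uP ulim.
pose v n := u (n + N)%N; pose m n : R := (n + N)%:R.
have m1 n : 1 <= m n by rewrite ler1n addn_gt0 N0 orbT.
have v0 n : 0 < v n by have [] := uP (n + N)%N (leq_addl _ _).
have vS n : v n * (1 + 3 / m n) <= v n.+1 by have [] := uP (n + N)%N (leq_addl _ _).
have vp n : (54 * m n * (v n.+1 / v n) ^+ 3) ^+ p <= v n.
  by have [] := uP (n + N)%N (leq_addl _ _).
have p0 : (0 < p)%N.
  by rewrite lt0n; apply/eqP => p0; move: ps; rewrite p0 mul0r; lra.
have q1 n : 1 <= v n.+1 / v n.
  rewrite ler_pdivlMr // mul1r; apply: le_trans (vS n).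
  rewrite ler_peMr ?(ltW (v0 n)) //.
  by rewrite lerDl divr_ge0 // (le_trans ler01 (m1 n)).
have q3 n : 1 <= (v n.+1 / v n) ^+ 3 by rewrite exprn_ege1.
have c1 n : 54 * m n <= 54 * m n * (v n.+1 / v n) ^+ 3.
  by rewrite ler_peMr //; have := m1 n; lra.
have v54 n : 54 * m n <= v n.
  apply: le_trans (vp n); apply: le_trans (c1 n) _.
  by apply: ler_eXnr => //; have := c1 n; have := m1 n; lra.
have vm n : 54 <= v n / m n by rewrite ler_pdivlMr // (lt_le_trans ltr01 (m1 n)).
pose a n := (Num.truncn (v n)).+1; pose b n := Num.truncn (v n / m n).
have aP n : v n < (a n)%:R <= v n + 1.
  have /truncn_itv/andP[h1 h2] := ltW (v0 n).
  by rewrite h2 -natr1 lerD2r.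
have bP n : v n / m n - 1 < (b n)%:R <= v n / m n.
  have /truncn_itv/andP[h1 h2] : 0 <= v n / m n by have := vm n; lra.
  by rewrite h1 andbT ltrBlDr natr1.
have vmv n : v n / m n <= v n.
  by rewrite ler_pdivrMr ?(lt_le_trans ltr01 (m1 n)) // ler_peMr // ltW.
have b1 n : (1 < b n)%N.
  by rewrite -(ltr_nat R); have /andP[] := bP n; have := vm n; lra.
have tP n : v n <= (a n + b n)%:R <= 3 * v n.
  rewrite natrD; have := aP n; have := bP n; have := vm n; have := vmv n.
  by have : 0 <= (b n)%:R :> R by []; lra.
apply: (@restricted_digits_measure_neq0 R a b s) => //.
- move=> n; rewrite -(ltr_nat R) natrD.
  have := vS n; rewrite mulrDr mulr1 mulrCA.
  by have := aP n; have := aP n.+1; have := bP n; have := vm n; lra.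
- move=> n.
  set w := _ / _.
  have w0 : 0 <= w by rewrite divr_ge0 // exprn_ge0.
  (* The sums [a + b] lie between [v] and [3 * v], hence [w <= z]; the factor
     [54 * m n] of the third condition on [u] is what is left when [z] is
     compared with half of [v n / m n], a lower bound for [b n]. *)
  pose z := 27 * (v n.+1 / v n) ^+ 3 * v n.
  have vz : v n <= z.
    rewrite /z -[leLHS]mul1r ler_pM2r //; have := q3 n; lra.
  have wz : w <= z.
    have /andP[h1 _] := tP n; have /andP[_ h2] := tP n.+1.
    have v0' := v0 n.
    rewrite /w ler_pdivrMr ?exprn_gt0 ?(lt_le_trans (v0 n)) //.
    apply: (@le_trans _ _ ((3 * v n.+1) ^+ 3)).
      by rewrite lerXn2r // nnegrE // mulr_ge0 // ltW.
    have zE : z * v n ^+ 2 = (3 * v n.+1) ^+ 3.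
      by rewrite /z; field; rewrite gt_eqF.
    rewrite -zE; apply: ler_wpM2l; first by apply: le_trans vz; exact: ltW.
    by rewrite lerXn2r // nnegrE ltW.
  have z1 : 1 <= z by have := v54 n; have := m1 n; lra.
  apply: (le_trans (ge0_ler_powR s0 _ _ wz)); rewrite ?nnegrE //; first lra.
  have cpos : 0 < 54 * m n * (v n.+1 / v n) ^+ 3.
    by have := c1 n; have := m1 n; lra.
  apply: (le_trans (powR_le_div z1 cpos (le_trans (vp n) vz) ps)).
  have -> : z / (54 * m n * (v n.+1 / v n) ^+ 3) = (v n / m n) / 2.
    rewrite /z; field.
    by rewrite !gt_eqF //; have := m1 n; lra.
  by have := bP n; have := vm n; lra.
move=> d dd dP; split.
- rewrite pierce_value_gt0 //= ltW //; apply: (lt_le_trans (pierce_value_lt R dd)).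
  by rewrite invf_le1 ?ltr0n ?ler1n ?admissible_gt0.
- exact: pierce_value_irrational.
have mlim : 1 + 2 / m n @[n --> \oo] --> (1 : R).
  rewrite -[X in _ --> X]addr0; apply: cvgD; first exact: cvg_cst.
  rewrite -[X in _ --> X](mulr0 2); apply: cvgMl_tmp.
  by rewrite (cvg_shiftn N (fun n => n%:R^-1 : R)); exact: cvg_invn.
have rlim : (d n)%:R / v n @[n --> \oo] --> (1 : R).
  apply: (@squeeze_cvgr _ _ _ _ (fun=> 1) (fun n => 1 + 2 / m n)) => //; last first.
    exact: cvg_cst.
  near=> n.
  have /andP[h1 h2] := dP n.
  rewrite ler_pdivlMr // mul1r ler_pdivrMr //.
  have h1' : (a n)%:R <= (d n)%:R :> R by rewrite ler_nat.
  have h2' : (d n)%:R < (a n)%:R + (b n)%:R :> R by rewrite -natrD ltr_nat.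
  rewrite mulrDl mul1r mulrAC -mulrA.
  by have := aP n; have := bP n; have := vm n; lra.
pose x := pierce_value R d.
rewrite -(cvg_shiftS (fun n =>
  ((pierce_digit n.+1 x)%:~R / (pierce_digit n x)%:~R)%:E : \bar R)) /=.
(* The ratio of the digits is the ratio of the [v]'s times a factor tending
   to one; the product is taken in the extended reals since [alpha] may be
   infinite. *)
rewrite (_ : (fun n => _) = (fun n => (v n.+1 / v n)%:E *
    (((d n.+1)%:R / v n.+1) * ((d n)%:R / v n)^-1)%:E)%E); last first.
  apply/funext => n; rewrite !pierce_digit_value // -!pmulrn -EFinM; congr EFin.
  have := v0 n; have := v0 n.+1 => h1 h2; have h3 : (0 : R) < (d n)%:R.
    by rewrite ltr0n admissible_gt0.
  by field; rewrite !gt_eqF.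
rewrite -[alpha]mule1; apply: cvgeM.
- by rewrite /mule_def; case: alpha {ulim} => //= r;
    rewrite ?onee_eq0 ?andbF // orbF.
- by move: ulim; rewrite -(cvg_shiftn N).
apply: cvg_EFin; first by near=> n.
have rlimS : (d n.+1)%:R / v n.+1 @[n --> \oo] --> (1 : R).
  by rewrite (cvg_shiftS (fun n => (d n)%:R / v n : R)).
have rlimV : ((d n)%:R / v n)^-1 @[n --> \oo] --> (1^-1 : R).
  by apply: cvgV => //; exact: oner_neq0.
have := cvgM rlimS rlimV; rewrite invr1 mulr1; exact.
Unshelve. all: by end_near. Qed.

(** For a finite limit the growth [alpha ^+ m * m ^+ p.+2] works; the factor
    [m ^+ p.+2] is what makes room for many digits when [alpha] is one. *)
Lemma ratio_set_measure_neq0_fin (alpha s : R) : 1 <= alpha -> 0 <= s < 1 ->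
  hausdorff_measure s (pierce_ratio_set alpha%:E) != 0%E.
Proof.
move=> a1 /andP[s0 s1].
have a0 : 0 < alpha by lra.
have s1' : 0 < 1 - s by lra.
have [p p0 ps] := natmul_ge1 s1'.
pose K := alpha * 2 ^+ p.+2.
have K0 : 0 < K by rewrite mulr_gt0 // exprn_gt0.
pose N := (Num.truncn ((54 * K ^+ 3) ^+ p)).+1.
pose u m : R := alpha ^+ m * m%:R ^+ p.+2.
have uE m : (0 < m)%N -> u m.+1 / u m = alpha * (1 + m%:R^-1) ^+ p.+2.
  move=> m0; have m0R : (0 : R) < m%:R by rewrite ltr0n.
  have -> : 1 + m%:R^-1 = m.+1%:R / m%:R :> R.
    by rewrite -natr1; field; rewrite gt_eqF.
  rewrite /u exprS expr_div_n; field.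
  by rewrite !gt_eqF // exprn_gt0.
apply: (@growth_measure_neq0 _ _ p N u) => // [m Nm|].
  have m0 : (0 < m)%N by exact: leq_trans Nm.
  have m1 : (1 : R) <= m%:R by rewrite ler1n.
  have mi1 : m%:R^-1 <= 1 :> R by rewrite invf_le1 // ltr0n.
  have mi0 : 0 < m%:R^-1 :> R by rewrite invr_gt0 ltr0n.
  have u0 : 0 < u m by rewrite mulr_gt0 ?exprn_gt0 // ltr0n.
  have qE := uE m m0.
  have a1m : 1 <= alpha ^+ m by rewrite exprn_ege1.
  split => //.
    rewrite mulrC -ler_pdivlMr // qE -[leLHS]mul1r.
    apply: ler_pM => //.
    apply: (@le_trans _ _ ((1 + m%:R^-1) ^+ 3)).
      by move: mi0; set t : R := m%:R^-1; nra.
    by apply: ler_weXn2l => //; rewrite ?lerDl ?ltW //; lia.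
  apply: (@le_trans _ _ ((54 * m%:R * K ^+ 3) ^+ p)).
    have q0 : 0 <= u m.+1 / u m by rewrite qE mulr_ge0 ?exprn_ge0 ?addr_ge0 // ltW.
    have qK : u m.+1 / u m <= K.
      rewrite qE ler_pM2l //; apply: lerXn2r; rewrite ?nnegrE //; lra.
    have q3 : (u m.+1 / u m) ^+ 3 <= K ^+ 3.
      by apply: lerXn2r qK; rewrite nnegrE // ltW.
    have c0 : (0 : R) <= 54 * m%:R by rewrite mulr_ge0.
    apply: lerXn2r (ler_wpM2l c0 q3); rewrite nnegrE mulr_ge0 ?exprn_ge0 //.
    exact: ltW.
  rewrite mulrAC exprMn; apply: (@le_trans _ _ (m%:R * m%:R ^+ p)).
    rewrite ler_pM2r ?exprn_gt0 ?ltr0n //.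
    have /truncn_itv/andP[_ /ltW h] : 0 <= (54 * K ^+ 3) ^+ p.
      by apply/exprn_ge0/mulr_ge0 => //; apply/exprn_ge0/ltW.
    by apply: le_trans h _; rewrite ler_nat.
  rewrite -exprS /u -[leLHS]mul1r; apply: ler_pM => //.
  exact: ler_weXn2l.
apply: cvg_EFin; first by near=> m.
rewrite -(cvg_shiftS (fine \o (fun m => (u m.+1 / u m)%:E))) /=.
rewrite (_ : (fun m => _) = (fun m => alpha * (1 + m.+1%:R^-1) ^+ p.+2)); last first.
  by apply/funext => m; rewrite uE.
have h : (1 + m.+1%:R^-1 : R) @[m --> \oo] --> (1 : R).
  have := cvgD (cvg_cst (1 : R)) (@cvg_harmonic R).
  rewrite addr0; exact.
have {}h := cvg_comp _ _ h (@exprn_continuous R p.+2 1).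
have := cvgMl_tmp (a := alpha) h; rewrite expr1n mulr1; exact.
Unshelve. all: by end_near. Qed.

(** For an infinite limit the growth [2 ^+ (m * m)] works: consecutive ratios
    are [2 ^+ (2 * m).+1], unbounded but with exponent linear in [m] only. *)
Lemma ratio_set_measure_neq0_pinfty (s : R) : 0 <= s < 1 ->
  hausdorff_measure s (pierce_ratio_set +oo%E) != 0%E.
Proof.
move=> /andP[s0 s1].
have s1' : 0 < 1 - s by lra.
have [p p0 ps] := natmul_ge1 s1'.
pose u m : R := 2 ^+ (m * m).
have uE m : u m.+1 / u m = 2 ^+ (2 * m).+1.
  rewrite /u (_ : (m.+1 * m.+1 = m * m + (2 * m).+1)%N); last by lia.
  by rewrite exprD mulrAC divff ?mul1r // expf_neq0.
apply: (@growth_measure_neq0 _ _ p (16 * p)%N u) => // [|m Nm|].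
- by rewrite muln_gt0.
- have m0 : (0 < m)%N by apply: leq_trans Nm; rewrite muln_gt0.
  have m1 : (1 : R) <= m%:R by rewrite ler1n.
  have u0 : 0 < u m by rewrite exprn_gt0.
  split => //.
    rewrite mulrC -ler_pdivlMr // uE; apply: (@le_trans _ _ (2 ^+ 3)).
      have mi1 : m%:R^-1 <= 1 :> R by rewrite invf_le1 // ltr0n.
      by rewrite -natrX; lra.
    by apply: ler_weXn2l; [lra|lia].
  rewrite uE; apply: (@le_trans _ _ ((2 ^+ (7 * m + 9)) ^+ p)).
    rewrite lerXn2r ?nnegrE ?mulr_ge0 ?exprn_ge0 //.
    rewrite (_ : (7 * m + 9 = 6 + m + (2 * m).+1 * 3)%N); last by lia.
    rewrite exprD -exprM; apply: ler_wpM2r; first by rewrite exprn_ge0.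
    rewrite exprD; apply: ler_pM => //; first by rewrite -natrX ler_nat.
    by rewrite -natrX ler_nat ltnW // ltn_expl.
  rewrite -exprM /u; apply: ler_weXn2l; first by lra.
  by move: Nm m0; nia.
apply/cvgeryP/cvgryPge => A; near=> m.
rewrite uE; apply: (@le_trans _ _ m%:R).
  near: m; exact: nbhs_infty_ger.
rewrite -natrX ler_nat; apply: ltnW; apply: (leq_ltn_trans _ (ltn_expl _ _)) => //.
by lia.
Unshelve. all: by end_near. Qed.

End Growth.

(** * Monotonicity of the digits *)

Section Monotone.
Variable R : realType.
Implicit Types x : R.

Definition irrational_unit x : Prop := 0 < x <= 1 /\ irrational x.

Lemma pierce_d1_ge1 x : 0 < x <= 1 -> (1 <= pierce_d1 x)%R.
Proof.
by move=> /andP[x0 x1]; rewrite /pierce_d1 div1r floor_ge_int invf_ge1.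
Qed.

Lemma pierce_T_irrational x : 0 < x <= 1 -> irrational x -> irrational (pierce_T x).
Proof.
move=> /pierce_d1_ge1 d1 xirr [r _ rE]; apply: xirr.
exists ((1 - r) / (pierce_d1 x)%:~R) => //.
have d0 : (pierce_d1 x)%:~R != 0 :> R by rewrite intr_eq0; lia.
rewrite fmorph_div rmorphB rmorph1 /= ratr_int rE /pierce_T opprB addrC subrK.
by rewrite mulrC mulKf.
Qed.

Lemma pierce_T_unit x : 0 < x <= 1 -> irrational x ->
  0 < pierce_T x < (pierce_d1 x + 1)%:~R^-1.
Proof.
move=> x01 xirr; have d1 := pierce_d1_ge1 x01; have /andP[x0 x1] := x01.
have /andP[] := floor_itv (1 / x); rewrite -/(pierce_d1 x).
have D1 : (1 : R) <= (pierce_d1 x)%:~R by rewrite ler1z.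
have Tn0 : pierce_T x != 0.
  apply/eqP => T0; apply: (pierce_T_irrational x01 xirr).
  by exists 0; rewrite // rmorph0.
move: Tn0; rewrite /pierce_T intrD; move: D1; set D : R := (pierce_d1 x)%:~R => D1.
rewrite ler_pdivlMr // ltr_pdivrMr // => Tn0 h1 h2.
have h3 : 0 <= 1 - D * x by lra.
rewrite lt_neqAle eq_sym Tn0 h3 /= -[ltRHS]mul1r ltr_pdivlMr; nra.
Qed.

Lemma pierce_T_irrational_unit x : irrational_unit x -> irrational_unit (pierce_T x).
Proof.
move=> [x01 xirr]; split; last exact: pierce_T_irrational.
have /andP[-> h] := pierce_T_unit x01 xirr; apply: ltW (lt_le_trans h _).
have d1 := pierce_d1_ge1 x01.
by rewrite invf_le1 ?ltr0z ?ler1z; lia.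
Qed.

(** [pierce_T x] falls below [1 / (pierce_d1 x + 1)], the left end of the
    cylinder of [x], so the next digit is larger. *)
Lemma pierce_d1_T x : irrational_unit x -> (pierce_d1 x < pierce_d1 (pierce_T x))%R.
Proof.
move=> [x01 xirr]; have /andP[T0 h] := pierce_T_unit x01 xirr.
have d1 := pierce_d1_ge1 x01.
rewrite -lezD1 [leRHS]/pierce_d1 div1r floor_ge_int -[leLHS]invrK.
by rewrite lef_pV2 ?posrE ?invr_gt0 ?ltr0z ?(ltW h) //; lia.
Qed.

Lemma pierce_ratio_set_lt1 (alpha : \bar R) :
  (alpha < 1)%E -> pierce_ratio_set alpha = set0.
Proof.
move=> a1; apply/seteqP; split => // x [x01 xirr lim].
move: a1; rewrite ltNge => /negP; apply.
apply: cvge_to_ge lim _; near=> n.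
have n0 : (0 < n)%N by near: n; exact: nbhs_infty_gt.
have xn k : irrational_unit (iter k (@pierce_T R) x).
  by elim: k => // k; exact: pierce_T_irrational_unit.
rewrite -(prednK n0) /pierce_digit /=; have := xn n.-1.
set y := iter _ _ _ => yu; have d1 := pierce_d1_ge1 yu.1.
rewrite lee_fin ler_pdivlMr ?ltr0z; last by lia.
by rewrite mul1r ler_int ltW // pierce_d1_T.
Unshelve. all: by end_near. Qed.

End Monotone.

Local Open Scope ereal_scope.

Theorem theorem1p8 (R : realType) (alpha : \bar R) :
  (1 <= alpha -> hausdorff_dim (pierce_ratio_set alpha) = 1) /\
  (alpha < 1 -> pierce_ratio_set alpha = set0 /\
                hausdorff_dim (pierce_ratio_set alpha) = 0).
Proof.
split=> [a1|a1]; last by rewrite pierce_ratio_set_lt1 // hausdorff_dim_set0.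
apply/eqP; rewrite eq_le; apply/andP; split.
  apply: hausdorff_dim_le1 => x [/andP[x0 x1] _ _] /=.
  by rewrite in_itv /= x1 ltW.
apply: hausdorff_dim_ge1 => s s01.
case: alpha a1 => [r|_|//]; last exact: ratio_set_measure_neq0_pinfty.
by rewrite lee_fin => r1; exact: ratio_set_measure_neq0_fin.
Qed.
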